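(* Let $E=(e_j)_{j\ge0}$ be a Leja sequence on the closed unit disc $\mathcal{U}$ with $e_0\in\partial\mathcal{U}$. Then $\mathbb{D}_0(E)=1$ and, for every $k\ge1$, $$\mathbb{D}_k(E)\le 1+\sqrt{\frac{k}{2^{p(k)}}\big(2^{\sigma_1(k)}-1\big)}\ \mathbb{L}_{2^{p(k)}} .$$
   Context: $\mathcal{U}=\{z\in\mathbb{C}:|z|\le 1\}$. A Leja sequence on $\mathcal{U}$ with $e_0\in\partial\mathcal{U}$ is a sequence $(e_j)_{j\ge0}$ such that $e_0\in\partial\mathcal U$ is arbitrary and, for every $k\ge1$, $e_k$ is one of the maximizers over $z\in\mathcal{U}$ of $|z-e_{k-1}|\cdots|z-e_0|$. For a compact $X$ and a sequence $Z=(z_j)_{j\ge0}$ of mutually distinct points of $X$, let $Z_k=(z_0,\dots,z_{k-1})$ and let $I_{Z_k}$ be the Lagrange interpolation operator at the points of $Z_k$ onto polynomials of degree at most $k-1$: $I_{Z_k}f(z)=\sum_{j=0}^{k-1}f(z_j)\,l_{j,k}(z)$ with $l_{j,k}(z)=\prod_{0\le i\le k-1,\ i\ne j}\frac{z-z_i}{z_j-z_i}$. The difference operators are $\Delta_0=I_{Z_1}$ and $\Delta_k=I_{Z_{k+1}}-I_{Z_k}$ for $k\ge1$, and $$\mathbb{D}_k(Z)=\max_{f\in C(X)\setminus\{0\}}\frac{\|\Delta_kf\|_{L^\infty(X)}}{\|f\|_{L^\infty(X)}} .$$ Here $X=\mathcal{U}$. For $p\ge0$, $\mathbb{L}_{2^p}$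 is the Lebesgue constant of the set $S$ of $2^p$-th roots of unity on $\mathcal{U}$, i.e. $\mathbb{L}_{2^p}=\max_{z\in\mathcal{U}}\sum_{s\in S}\prod_{t\in S,\,t\ne s}\big|\frac{z-t}{s-t}\big|$. For an integer $k\ge1$, $\sigma_1(k)$ is the number of ones in the binary expansion of $k$, and $p(k)$ is the largest integer $p$ such that $2^p$ divides $k$. *)

(* Defs.v *)
From HB Require Import structures.
From mathcomp Require Import all_boot all_order all_algebra.
From mathcomp Require Import complex.
From mathcomp Require Import all_classical all_reals all_analysis.
Import Order.TTheory GRing.Theory Num.Theory.
Import numFieldNormedType.Exports.

Set Implicit Arguments.
Unset Strict Implicit.
Unset Printing Implicit Defensive.

Local Open Scope classical_set_scope.
Local Open Scope complex_scope.
Local Open Scope ring_scope.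

(* The norm `|z| of z : R[i] lives in R[i]; this is the modulus as an element
   of R. *)
Notation cabs := ComplexField.Normc.normc.

Definition unit_disc (R : realType) : set R[i] := [set z | cabs z <= 1].

Definition leja (R : realType) (e : nat -> R[i]) : Prop :=
  cabs (e 0%N) = 1 /\
  forall k, (0 < k)%N ->
    unit_disc (e k) /\
    forall z, unit_disc z ->
      \prod_(j < k) cabs (z - e j) <= \prod_(j < k) cabs (e k - e j).

Definition lagrange_basis (R : realType) (Z : nat -> R[i]) (k j : nat)
    (z : R[i]) : R[i] :=
  \prod_(i < k | (i : nat) != j) ((z - Z i) / (Z j - Z i)).

Definition lagrange_interp (R : realType) (Z : nat -> R[i]) (k : nat)
    (f : R[i] -> R[i]) (z : R[i]) : R[i] :=
  \sum_(j < k) f (Z j) * lagrange_basis Z k j z.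

Definition diff_op (R : realType) (Z : nat -> R[i]) (k : nat)
    (f : R[i] -> R[i]) (z : R[i]) : R[i] :=
  if k is 0%N then lagrange_interp Z 1 f z
  else lagrange_interp Z k.+1 f z - lagrange_interp Z k f z.

(* Only meant for f continuous on a nonempty compact X, so that the real
   supremum is the maximum of the modulus (sup is 0 on unbounded sets). *)
Definition supnorm (R : realType) (X : set R[i]) (f : R[i] -> R[i]) : R :=
  sup [set cabs (f z) | z in X].

(* C(X) \ {0}, an element of C(X) being represented by any extension to the
   plane.  The regular module R[i]^o carries the topology of the modulus. *)
Definition nonzero_continuous_on (R : realType) (X : set R[i]) :
    set (R[i] -> R[i]) :=
  [set f | {within (X : set R[i]^o), continuous (f : R[i]^o -> R[i]^o)} /\
           exists2 z, X z & f z != 0].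

(* The maximum of ||Delta_k f|| / ||f||, as a supremum in the extended reals:
   an upper bound on it is then meaningful without knowing beforehand that
   the ratios are bounded. *)
Definition diff_norm (R : realType) (X : set R[i]) (Z : nat -> R[i])
    (k : nat) : \bar R :=
  ereal_sup [set (supnorm X (diff_op Z k f) / supnorm X f)%:E
            | f in nonzero_continuous_on X].

Definition unity_roots (R : realType) (n : nat) : set R[i] :=
  [set s | s ^+ n = 1].

(* Lebesgue constant on X of a finite set S of nodes. *)
Definition lebesgue_const (R : realType) (X S : set R[i]) : R :=
  sup [set \sum_(s \in S)
             \big[*%R/1]_(t \in S `\ s) cabs ((z - t) / (s - t))
      | z in X].

(* Number of ones in the binary expansion of k; the bits of index i >= k
   vanish since k < 2 ^ k. *)
Definition sigma1 (k : nat) : nat := (\sum_(i < k) odd (k %/ 2 ^ i))%N.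

(* Main.v *)
Require Import Defs.
From mathcomp Require Import all_boot all_order all_algebra.
From mathcomp Require Import complex.
From mathcomp Require Import all_classical all_reals all_analysis.
From mathcomp Require Import ring lra zify.
Import Order.TTheory GRing.Theory Num.Theory.
Import ComplexField.Normc.

(** Write [w_k(z)] for the product of the [z - e_j], [j < k].  Since [e_k]
    maximises [|w_k|] on the disc, and since
    [Delta_k f (z) = (f(e_k) - I_k f (e_k)) * w_k(z) / w_k(e_k)]
    ([diff_op_eq]), the norm of [Delta_k] is at most [1 + lambda_k(e_k)], where
    [lambda_k] is the Lebesgue function of the first [k] nodes.  Everything
    then rests on evaluating [lambda_k] at the single point [e_k].

    The tool is the squaring map.  A Leja sequence lies on the circle, comes in
    antipodal pairs [e_(2j+1) = - e_(2j)], and [F_j = e_(2j) ^ 2] is again a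
    Leja sequence, because [w_(2m)(z)] equals the corresponding polynomial of
    [F] at [z ^ 2].  This is one induction ([leja_upto_structure]), in
    which [|e_(2m)| = 1] is read off from [|F_m| = 1].

    For two quantities the passage from [e] to [F] reads off one binary digit
    of [k]: the maximum [|w_k(e_k)|] keeps its value for [k = 2m] and doubles
    for [k = 2m + 1], while the sum of the inverse squares of
    [|w_(k+1)'(e_i)|], [i <= k], keeps its value or is halved.  They are
    therefore [2 ^ sigma_1(k)] and [2 ^ - sigma_1(k)], and combining them shows
    that the squares of the [|l_(j,k)(e_k)|] sum up to exactly
    [2 ^ sigma_1(k) - 1] ([leja_lagrange_basis_sqr_sum]).  By Cauchy-Schwarz,
    [lambda_k(e_k) <= sqrt (k (2 ^ sigma_1(k) - 1))].

    Cauchy-Schwarz is wasteful when [k = 2 ^ p * m].  There the nodes split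
    into [m] consecutive blocks, each a rotated copy of the [2 ^ p]-th roots of
    unity, and [z |-> z ^ (2 ^ p)] collapses the blocks to the nodes of a Leja
    sequence [G], the [p]-th iterate of the squaring construction.  Hence
    [lambda_k(z)] is at most [L_(2 ^ p)] times the Lebesgue function of the
    first [m] nodes of [G] at [z ^ (2 ^ p)] ([leja_lebesgue_fun_blocks]), and
    the previous bound is applied to [G] and [m], where
    [sigma_1(m) = sigma_1(k)]. *)

Set Implicit Arguments.
Unset Strict Implicit.
Unset Printing Implicit Defensive.

Local Open Scope classical_set_scope.
Local Open Scope complex_scope.
Local Open Scope ring_scope.

(** * Modulus *)

Lemma cabs_ge0 (R : realType) (z : R[i]) : 0 <= cabs z.
Proof. by case: z => a b; apply: sqrtr_ge0. Qed.

Lemma cabs_eq0 (R : realType) (z : R[i]) : (cabs z == 0) = (z == 0).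
Proof.
by apply/eqP/eqP => [/eq0_normc//|->]; apply: normc0.
Qed.

Lemma cabs_gt0 (R : realType) (z : R[i]) : (0 < cabs z) = (z != 0).
Proof. by rewrite lt0r cabs_ge0 andbT cabs_eq0. Qed.

Lemma cabsX (R : realType) (z : R[i]) n : cabs (z ^+ n) = cabs z ^+ n.
Proof. by elim: n => [|n IH]; rewrite ?normc1// !exprS normcM IH. Qed.

Lemma cabs_prod (R : realType) (I : Type) (r : seq I) (P : pred I)
    (f : I -> R[i]) :
  cabs (\prod_(i <- r | P i) f i) = \prod_(i <- r | P i) cabs (f i).
Proof. by apply: big_morph; [exact: normcM | exact: normc1]. Qed.

Lemma cabs_sum_le (R : realType) (I : Type) (r : seq I) (P : pred I)
    (f : I -> R[i]) :
  cabs (\sum_(i <- r | P i) f i) <= \sum_(i <- r | P i) cabs (f i).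
Proof.
elim/big_rec2: _ => [|i y z _ le_zy]; first by rewrite normc0.
by rewrite (le_trans (le_normcD _ _))// lerD2l.
Qed.

Lemma cabs_parallelogram (R : realType) (x y : R[i]) :
  cabs (x - y) ^+ 2 + cabs (x + y) ^+ 2 = 2 * (cabs x ^+ 2 + cabs y ^+ 2).
Proof.
case: x => a b; case: y => c d; rewrite /= !sqr_sqrtr ?addr_ge0 ?sqr_ge0//.
by ring.
Qed.

(** Equality case of the triangle inequality on the disc: only the antipode of
    a point of the circle lies at distance 2 from it. *)
Lemma antipodal (R : realType) (x y : R[i]) :
  cabs x <= 1 -> cabs y = 1 -> 2 <= cabs (x - y) -> x = - y.
Proof.
move=> x1 y1 xy2; apply/eqP; rewrite -addr_eq0 -cabs_eq0 -sqrf_eq0.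
have := cabs_parallelogram x y; rewrite y1 expr1n => par.
have x21 : cabs x ^+ 2 <= 1 by rewrite expr_le1// cabs_ge0.
have : 2 ^+ 2 <= cabs (x - y) ^+ 2 by rewrite lerXn2r// ?nnegrE ?cabs_ge0.
rewrite eq_le sqr_ge0 andbT; move: par; lra.
Qed.

Lemma unit_disc0 (R : realType) : unit_disc (0 : R[i]).
Proof. by have := @ler01 R; rewrite -[X in X <= 1](@normc0 R). Qed.

(** * Iterated operations over consecutive blocks *)

Lemma big_blocks (T : Type) (idx : T) (op : Monoid.law idx) (m n : nat)
    (h : nat -> T) :
  \big[op/idx]_(j < m * n) h j =
  \big[op/idx]_(a < m) \big[op/idx]_(s < n) h (a * n + s)%N.
Proof.
elim: m => [|m IH]; first by rewrite mul0n !big_ord0.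
rewrite [RHS]big_ord_recr -IH /= -!(big_mkord xpredT) mulSnr.
rewrite (@big_cat_nat _ _ _ (m * n)) ?leq_addr//=; congr (op _ _).
by rewrite -{1}[(m * n)%N]add0n big_addn addKn !big_mkord; apply: eq_bigr => i _;
   rewrite addnC.
Qed.

Lemma big_blocks_excl (T : Type) (idx : T) (op : Monoid.com_law idx)
    (m n a s : nat) (h : nat -> T) : (a < m)%N -> (s < n)%N ->
  \big[op/idx]_(j < m * n | (j : nat) != (a * n + s)%N) h j =
  op (\big[op/idx]_(t < n | (t : nat) != s) h (a * n + t)%N)
     (\big[op/idx]_(b < m | (b : nat) != a)
        \big[op/idx]_(t < n) h (b * n + t)%N).
Proof.
move=> am sn; rewrite big_mkcond /=.
pose h' j := if j != (a * n + s)%N then h j else idx.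
rewrite (@big_blocks _ idx op m n h') (bigD1 (Ordinal am))//=; congr (op _ _).
  rewrite [RHS]big_mkcond; apply: eq_bigr => t _.
  by rewrite /h' eqn_add2l.
apply: eq_big => [b|b ba]; first by [].
apply: eq_bigr => t _; rewrite /h'; case: eqP => // E.
have n0 : (0 < n)%N by apply: leq_ltn_trans sn.
have : ((b * n + t) %/ n = (a * n + s) %/ n)%N by rewrite E.
rewrite !divnMDl// !divn_small// !addn0 => Eb.
by move: ba; rewrite -val_eqE /= Eb eqxx.
Qed.

Lemma big_pairs (T : Type) (idx : T) (op : Monoid.law idx) (m : nat)
    (h : nat -> T) :
  \big[op/idx]_(j < m.*2) h j = \big[op/idx]_(a < m) op (h a.*2) (h a.*2.+1).
Proof.
rewrite -muln2 big_blocks; apply: eq_bigr => a _.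
by rewrite !big_ord_recr big_ord0 /= Monoid.mul1m addn0 addn1 muln2.
Qed.

(** * Structure of Leja sequences *)

Definition square_seq (R : realType) (e : nat -> R[i]) : nat -> R[i] :=
  fun j => e j.*2 ^+ 2.

Definition node_dist (R : realType) (e : nat -> R[i]) (n : nat) (z : R[i]) : R :=
  \prod_(j < n) cabs (z - e j).

(** Finite sections make the induction on the index possible: that the squared
    sequence is Leja up to [m] depends only on the antipodal pairs below [2m],
    while being Leja as a whole depends on all of them. *)
Definition leja_upto (R : realType) (e : nat -> R[i]) (n : nat) : Prop :=
  cabs (e 0%N) = 1 /\
  forall k, (0 < k <= n)%N ->
    unit_disc (e k) /\
    forall z, unit_disc z -> node_dist e k z <= node_dist e k (e k).

Lemma leja_uptoP (R : realType) (e : nat -> R[i]) :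
  leja e <-> forall n, leja_upto e n.
Proof.
split=> [[e0 H] n|H]; first by split=> // k /andP[k0 _]; apply: H.
by split=> [|k k0]; [exact: (H 0%N).1 | apply: (H k).2; rewrite k0 leqnn].
Qed.

Lemma leja_upto_le (R : realType) (e : nat -> R[i]) m n :
  (m <= n)%N -> leja_upto e n -> leja_upto e m.
Proof.
move=> mn [e0 H]; split=> // k /andP[k0 km]; apply: H.
by rewrite k0 (leq_trans km).
Qed.

Lemma node_distS (R : realType) (e : nat -> R[i]) n z :
  node_dist e n.+1 z = node_dist e n z * cabs (z - e n).
Proof. exact: big_ord_recr. Qed.

(** The two nodes of an antipodal pair contribute the factor
    [(z - a) (z + a) = z ^ 2 - a ^ 2]. *)
Lemma node_dist_double (R : realType) (e : nat -> R[i]) m z :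
  (forall j, (j < m)%N -> e j.*2.+1 = - e j.*2) ->
  node_dist e m.*2 z = node_dist (square_seq e) m (z ^+ 2).
Proof.
elim: m => [|m IH] H; first by rewrite /node_dist !big_ord0.
rewrite doubleS !node_distS IH => [|j jm]; last exact/H/ltnW.
by rewrite H// opprK -mulrA -normcM -subr_sqr.
Qed.

(** Squaring maps the disc onto itself, so a maximiser [e_(2m)] of a function
    of [z ^ 2] gives a maximiser [e_(2m) ^ 2] of the corresponding function. *)
Lemma square_seq_leja_upto (R : realType) (e : nat -> R[i]) m :
  leja_upto e m.*2 -> (forall j, (j < m)%N -> e j.*2.+1 = - e j.*2) ->
  leja_upto (square_seq e) m.
Proof.
move=> [e0 H] anti; split=> [|k /andP[k0 km]].
  by rewrite /square_seq cabsX e0 expr1n.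
have antik j : (j < k)%N -> e j.*2.+1 = - e j.*2.
  by move=> jk; apply/anti/(leq_trans jk).
have [|ek1 ekmax] := H k.*2; first by rewrite double_gt0 k0 leq_double.
rewrite /unit_disc /= in ek1 ekmax *.
split=> [|z z1]; first by rewrite /square_seq cabsX expr_le1// cabs_ge0.
rewrite -[z]sqrtCK -node_dist_double// -[leRHS]node_dist_double//.
apply: ekmax; have : cabs (sqrtC z) ^+ 2 <= 1 by rewrite -cabsX sqrtCK.
by rewrite expr_le1// cabs_ge0.
Qed.

(** Strong induction on the index.  For an even index [2m > 0], the modulus of
    [e_(2m)] comes from the term of index [m] of the squared sequence.  For an
    odd index, [- e_(2m)] maximises both factors of [w_(2m+1)] separately: it
    is the farthest point from [e_(2m)], and [w_(2m)] is even.  A maximiser of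
    the product must therefore be at distance 2 from [e_(2m)]. *)
Lemma leja_upto_structure (R : realType) k (e : nat -> R[i]) :
  leja_upto e k -> cabs (e k) = 1 /\ (odd k -> e k = - e k.-1).
Proof.
elim/ltn_ind: k e => k IH e lek.
have norm1 j : (j < k)%N -> cabs (e j) = 1.
  by move=> jk; apply: (IH j jk e _).1; apply: leja_upto_le lek; apply: ltnW.
have anti j : (j.*2.+1 < k)%N -> e j.*2.+1 = - e j.*2.
  move=> jk; apply: (IH _ jk e _).2; first exact/leja_upto_le/lek/ltnW.
  by rewrite /= odd_double.
have [m km] : exists m, k = m.*2 \/ k = m.*2.+1.
  exists k./2; rewrite -[k in k = _]odd_double_half -[k in _ \/ k = _]odd_double_half.
  by case: (odd k); [right|left].
have antim j : (j < m)%N -> e j.*2.+1 = - e j.*2.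
  by move=> jm; apply: anti; lia.
have lesq : leja_upto (square_seq e) m.
  by apply: square_seq_leja_upto => //; apply: leja_upto_le lek; lia.
case: km => km; last first.
  have cm : cabs (e m.*2) = 1 by apply: norm1; lia.
  have ek : e k = - e m.*2.
    have [|ek1 ekmax] := lek.2 k; first lia.
    apply: antipodal => //.
    (* At the centre of the disc all distances to the nodes are 1. *)
    have M0 : 0 < node_dist e m.*2 (e m.*2).
      have [->|m0] := posnP m; first by rewrite /node_dist big_ord0.
      have [|_ /(_ 0)] := lek.2 m.*2; first by lia.
      move=> /(_ (unit_disc0 R)); apply: lt_le_trans.
      apply: prodr_gt0 => j _; rewrite sub0r normcN norm1//.
      by rewrite km ltnS ltnW.
    have leM : node_dist e m.*2 (e k) <= node_dist e m.*2 (e m.*2).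
      have [->|m0] := posnP m; first by rewrite /node_dist !big_ord0.
      by have [|_ /(_ (e k))] := lek.2 m.*2; [lia | apply].
    have := ekmax (- e m.*2); rewrite /unit_disc /= normcN cm => /(_ (lexx _)).
    rewrite {1 2}km !node_distS !node_dist_double// sqrrN.
    rewrite -!node_dist_double// -opprD normcN -mulr2n normcMn cm => M2.
    rewrite -(ler_pM2l M0) (le_trans M2)//.
    by rewrite ler_wpM2r ?cabs_ge0.
  split; first by rewrite ek normcN.
  by rewrite km /= -km.
split; last by rewrite km odd_double.
have [m0|m0] := posnP m; first by rewrite km m0 lek.1.
have /IH/(_ _ lesq)[+ _] : (m < k)%N by lia.
by rewrite /square_seq cabsX -km => /eqP; rewrite pexpr_eq1 ?cabs_ge0// => /eqP.
Qed.

Lemma leja_cabs (R : realType) (e : nat -> R[i]) k : leja e -> cabs (e k) = 1.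
Proof. by move=> /leja_uptoP/(_ k)/leja_upto_structure[]. Qed.

Lemma leja_antipodal (R : realType) (e : nat -> R[i]) j :
  leja e -> e j.*2.+1 = - e j.*2.
Proof.
move=> /leja_uptoP/(_ j.*2.+1)/leja_upto_structure[_] /=.
by rewrite odd_double => /(_ isT).
Qed.

Lemma leja_square_seq (R : realType) (e : nat -> R[i]) :
  leja e -> leja (square_seq e).
Proof.
move=> le; apply/leja_uptoP => n; apply: square_seq_leja_upto.
  exact: (leja_uptoP e).1.
by move=> j _; apply: leja_antipodal.
Qed.

Lemma leja_square (R : realType) (e : nat -> R[i]) j :
  leja e -> e j ^+ 2 = square_seq e j./2.
Proof.
move=> le; rewrite /square_seq -{1}[j]odd_double_half.
by case: (odd j); rewrite ?add0n// add1n leja_antipodal// sqrrN.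
Qed.

(** * Binary digit sum and the maxima of the node polynomials *)

Lemma sigma1_bound (k n : nat) :
  (k <= n)%N -> sigma1 k = (\sum_(i < n) odd (k %/ 2 ^ i))%N.
Proof.
move=> kn; rewrite /sigma1 -!(big_mkord xpredT (fun i => nat_of_bool (odd (k %/ 2 ^ i)))).
rewrite [RHS](@big_cat_nat _ _ _ k)//= [X in (_ + X)%N]big1_seq ?addn0// => i.
rewrite mem_index_iota => /andP[_ /andP[ki _]].
by rewrite divn_small// (leq_ltn_trans ki)// ltn_expl.
Qed.

(** The lowest bit splits off; the others are those of [m], shifted. *)
Lemma sigma1_bit (b : bool) (m : nat) : sigma1 (b + m.*2) = (b + sigma1 m)%N.
Proof.
have bm : (b + m.*2 <= (m.*2).+1)%N by case: b; lia.
rewrite (sigma1_bound bm) (@sigma1_bound m m.*2); last by lia.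
rewrite big_ord_recl expn0 divn1 oddD odd_double addbF oddb; congr (_ + _)%N.
apply: eq_bigr => i _; rewrite lift0 expnS divnMA.
by rewrite divn2 half_bit_double.
Qed.

Lemma sigma1_mul_exp2 p m : sigma1 (2 ^ p * m) = sigma1 m.
Proof.
elim: p => [|p IH]; first by rewrite mul1n.
by rewrite expnS -mulnA mul2n (sigma1_bit false).
Qed.

(** For [k = 2m] this is the value at [m] for the squared sequence; for
    [k = 2m + 1] there is one more factor, the distance 2 between the antipodal
    points [e_k] and [e_(2m)]. *)
Lemma leja_node_dist (R : realType) k (e : nat -> R[i]) :
  leja e -> node_dist e k (e k) = 2 ^+ sigma1 k.
Proof.
elim/ltn_ind: k e => k IH e le.
have [->|k0] := posnP k; first by rewrite /node_dist /sigma1 !big_ord0.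
have sq : node_dist e k./2.*2 (e k./2.*2) = 2 ^+ sigma1 k./2.
  rewrite node_dist_double => [|j _]; last exact: leja_antipodal.
  by rewrite leja_square// doubleK IH//; [lia | exact: leja_square_seq].
rewrite -{1 2}[k]odd_double_half -[in RHS](odd_double_half k) sigma1_bit.
case: (odd k); last by rewrite !add0n sq.
rewrite !add1n node_distS.
rewrite {1}leja_antipodal// node_dist_double => [|j _]; last exact: leja_antipodal.
rewrite sqrrN -node_dist_double => [|j _]; last exact: leja_antipodal.
rewrite sq leja_antipodal// -opprD normcN -mulr2n normcMn leja_cabs//.
by rewrite exprS mulrC.
Qed.

Lemma leja_neq (R : realType) (e : nat -> R[i]) i j :
  leja e -> i != j -> e i != e j.
Proof.
move=> le; have dist a b : (b < a)%N -> e a != e b.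
  move=> ba; have : node_dist e a (e a) != 0 by rewrite leja_node_dist// expf_neq0.
  by move/prodf_neq0/(_ (Ordinal ba) isT); rewrite cabs_eq0 subr_eq0.
by rewrite neq_ltn => /orP[/dist|/dist//]; rewrite eq_sym.
Qed.

(** * Sum of squares of the Lagrange basis at the next node *)

(** The modulus at [e_i] of the derivative of the node polynomial [w_n]. *)
Definition node_weight (R : realType) (e : nat -> R[i]) (n i : nat) : R :=
  \prod_(l < n | (l : nat) != i) cabs (e i - e l).

Lemma node_weightS (R : realType) (e : nat -> R[i]) n i : (i < n)%N ->
  node_weight e n.+1 i = node_weight e n i * cabs (e i - e n).
Proof.
by move=> ni; rewrite /node_weight big_mkcond big_ord_recr -big_mkcond /= gtn_eqF.
Qed.

Lemma node_weight_last (R : realType) (e : nat -> R[i]) n :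
  node_weight e n.+1 n = node_dist e n (e n).
Proof.
rewrite /node_weight big_mkcond big_ord_recr /= eqxx mulr1.
by apply: eq_bigr => i _; rewrite ltn_eqF.
Qed.

Lemma leja_node_weight_gt0 (R : realType) (e : nat -> R[i]) n i :
  leja e -> 0 < node_weight e n i.
Proof.
move=> le; apply: prodr_gt0 => l li.
by rewrite cabs_gt0 subr_eq0 leja_neq// eq_sym.
Qed.

(** The node [e_i] is at distance 2 from its antipode, and each other pair
    contributes [|e_i ^ 2 - e_(2b) ^ 2|]. *)
Lemma leja_node_weight_double (R : realType) (e : nat -> R[i]) m i :
  leja e -> (i./2 < m)%N ->
  node_weight e m.*2 i = 2 * node_weight (square_seq e) m i./2.
Proof.
move=> le im.
have ei : i = (i./2 * 2 + odd i)%N by rewrite -[LHS]odd_double_half muln2 addnC.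
have b2 : (odd i < 2)%N by case: odd.
rewrite /node_weight -muln2.
rewrite (eq_bigl (fun l : 'I_(m * 2) => (l : nat) != i./2 * 2 + odd i)%N);
  last by move=> l; rewrite -ei.
rewrite (@big_blocks_excl _ _ _ m 2 i./2 (odd i) (fun l => cabs (e i - e l)))//.
congr (_ * _); last first.
  apply: eq_bigr => b _; rewrite !big_ord_recr big_ord0 /= mul1r addn0 addn1 muln2.
  by rewrite leja_antipodal// opprK -normcM -subr_sqr leja_square.
rewrite big_mkcond !big_ord_recr big_ord0 /= mul1r addn0 addn1 muln2.
rewrite leja_antipodal// opprK.
have c2 : cabs (e i./2.*2 + e i./2.*2) = 2.
  by rewrite -mulr2n normcMn leja_cabs.
have -> : e i = (-1) ^+ odd i * e i./2.*2.
  rewrite -[i in LHS]odd_double_half; case: (odd i); last by rewrite mul1r.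
  by rewrite add1n leja_antipodal// mulN1r.
case: (odd i); rewrite /= ?expr1 ?expr0 ?mulN1r ?mul1r ?mulr1//.
by rewrite -opprD normcN.
Qed.

Definition inv_weight_sum (R : realType) (e : nat -> R[i]) (n : nat) : R :=
  \sum_(i < n) (node_weight e n i) ^- 2.

Lemma inv_weight_sum_even (R : realType) (e : nat -> R[i]) m :
  leja e ->
  inv_weight_sum e m.*2 = inv_weight_sum (square_seq e) m / 2.
Proof.
move=> le; rewrite /inv_weight_sum.
rewrite (@big_pairs _ _ _ m (fun i => node_weight e m.*2 i ^- 2)) mulr_suml.
apply: eq_bigr => a _.
rewrite !leja_node_weight_double//= ?uphalf_double ?doubleK//.
have := leja_node_weight_gt0 m a (leja_square_seq le).
by move=> w0; field; rewrite gt_eqF.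
Qed.

(** The node [e_(2m)] has no partner, and enters the weights of [e_(2a)] and
    [- e_(2a)] through its distances [x], [y] to them.  As [x ^ 2 + y ^ 2 = 4]
    on the circle, [1 / (2x) ^ 2 + 1 / (2y) ^ 2 = 1 / (x y) ^ 2], and
    [x y = |F_a - F_m|] with [F] the squared sequence. *)
Lemma inv_weight_sum_odd (R : realType) (e : nat -> R[i]) m :
  leja e ->
  inv_weight_sum e m.*2.+1 = inv_weight_sum (square_seq e) m.+1.
Proof.
move=> le; rewrite /inv_weight_sum !big_ord_recr /=; congr (_ + _); last first.
  rewrite !node_weight_last node_dist_double => [|j _]; last exact: leja_antipodal.
  by rewrite leja_square// doubleK.
rewrite (@big_pairs _ _ _ m (fun i => node_weight e m.*2.+1 i ^- 2)).
apply: eq_bigr => a _.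
have am := ltn_ord a.
rewrite !node_weightS; [|lia..].
rewrite !leja_node_weight_double//= ?uphalf_double ?doubleK//.
have w0 := leja_node_weight_gt0 m a (leja_square_seq le).
rewrite /square_seq subr_sqr normcM leja_antipodal//.
have := cabs_parallelogram (e a.*2) (e m.*2); rewrite !leja_cabs//.
have : cabs (e a.*2 - e m.*2) != 0 by rewrite cabs_eq0 subr_eq0 leja_neq//; lia.
have : cabs (e a.*2 + e m.*2) != 0.
  rewrite cabs_eq0 -[e m.*2]opprK -leja_antipodal// subr_eq0 leja_neq//; lia.
rewrite -opprD normcN -/(square_seq e).
set x := cabs (_ - _); set y := cabs (_ + _); set w := node_weight _ _ _.
move=> y0 x0; rewrite expr1n => xy.
have -> : (2 * w * x) ^- 2 + (2 * w * y) ^- 2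
    = (x ^+ 2 + y ^+ 2) / (4 * (w * (x * y)) ^+ 2).
  by field; rewrite x0 y0 gt_eqF.
by rewrite xy; field; rewrite x0 y0 gt_eqF.
Qed.

Lemma leja_inv_weight_sum (R : realType) k (e : nat -> R[i]) :
  leja e -> inv_weight_sum e k.+1 = 2 ^- sigma1 k.
Proof.
elim/ltn_ind: k e => k IH e le.
have [->|k0] := posnP k.
  rewrite /inv_weight_sum big_ord1 /= node_weight_last.
  by rewrite leja_node_dist// /sigma1 !big_ord0 expr0 expr1n.
have IH2 : inv_weight_sum (square_seq e) k./2.+1 = 2 ^- sigma1 k./2.
  by apply: IH; [lia | exact: leja_square_seq].
rewrite -[in RHS](odd_double_half k) sigma1_bit -{1}[k]odd_double_half.
case: (odd k); last by rewrite !add0n inv_weight_sum_odd.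
rewrite add1n -doubleS inv_weight_sum_even// IH2.
by rewrite exprS invfM mulrC.
Qed.

Definition lebesgue_fun (R : realType) (e : nat -> R[i]) (k : nat) (z : R[i]) : R :=
  \sum_(j < k) cabs (lagrange_basis e k j z).

(** Cauchy-Schwarz against the constant vector: the variance is nonnegative. *)
Lemma sqr_sum_le (R : realType) (n : nat) (x : 'I_n -> R) :
  (\sum_i x i) ^+ 2 <= n%:R * \sum_i x i ^+ 2.
Proof.
case: n x => [|n] x; first by rewrite !big_ord0 expr0n mul0r.
set S := \sum_i x i; set Q := \sum_i x i ^+ 2; set N := n.+1%:R : R.
have N0 : 0 < N by rewrite ltr0n.
have : 0 <= \sum_i (x i - S / N) ^+ 2 by apply: sumr_ge0 => i _; exact: sqr_ge0.
have -> : \sum_i (x i - S / N) ^+ 2 = Q - S ^+ 2 / N.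
  under eq_bigr do rewrite sqrrB -mulr_natr -mulrA.
  rewrite big_split sumrB /= -mulr_suml sumr_const card_ord -/S -/Q -mulr_natr -/N.
  by field; rewrite gt_eqF.
by rewrite subr_ge0 ler_pdivrMr// mulrC.
Qed.

(** [|l_(j,k)(e_k)|] is the quotient of [|w_k(e_k)|] by the weight of [e_j]
    among the first [k + 1] nodes, and that of [e_k] itself is [|w_k(e_k)|].
    With [s = 2 ^ sigma_1(k)] the sum is thus [s ^ 2 (1 / s - 1 / s ^ 2)]. *)
Lemma leja_lagrange_basis_sqr_sum (R : realType) (e : nat -> R[i]) k : leja e ->
  \sum_(j < k) cabs (lagrange_basis e k j (e k)) ^+ 2 = 2 ^+ sigma1 k - 1.
Proof.
move=> le.
have D := leja_node_dist k le.
have := leja_inv_weight_sum k le.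
rewrite /inv_weight_sum big_ord_recr /= node_weight_last D => /esym S.
set s := 2 ^+ sigma1 k in S D *.
have s0 : s != 0 by rewrite expf_neq0.
have -> : s - 1 = s ^+ 2 * (s^-1 - s ^- 2) by field.
rewrite S addrK mulr_sumr; apply: eq_bigr => j _.
rewrite -exprVn -exprMn; congr (_ ^+ 2).
rewrite node_weightS// -D /node_dist (bigD1 j)//= /lagrange_basis cabs_prod.
under eq_bigr do rewrite normcM normcV.
rewrite prodf_div -/(node_weight e k j).
have w0 := leja_node_weight_gt0 k j le.
have kj : cabs (e k - e j) != 0.
  by rewrite cabs_eq0 subr_eq0 leja_neq// gtn_eqF.
have -> : cabs (e j - e k) = cabs (e k - e j) by rewrite -opprB normcN.
set A := \prod_(i < k | (i : nat) != j) cabs (e k - e i).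
by field; rewrite kj gt_eqF.
Qed.

Lemma leja_lebesgue_fun_le (R : realType) (e : nat -> R[i]) k : leja e ->
  lebesgue_fun e k (e k) <= Num.sqrt (k%:R * (2 ^+ sigma1 k - 1)).
Proof.
move=> le; rewrite -(leja_lagrange_basis_sqr_sum k le).
have l0 : 0 <= lebesgue_fun e k (e k) by apply: sumr_ge0 => i _; exact: cabs_ge0.
rewrite -[leLHS]ger0_norm// -sqrtr_sqr ler_wsqrtr//.
exact: sqr_sum_le.
Qed.

(** * Blocks of length a power of two *)

Lemma leja_iter_square (R : realType) p (e : nat -> R[i]) :
  leja e -> leja (iter p (@square_seq R) e).
Proof. by move=> le; elim: p => //= p; exact: leja_square_seq. Qed.

(** In particular [e_j ^ (2 ^ p)] only depends on the block of length [2 ^ p]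
    that contains [j]. *)
Lemma leja_exp2 (R : realType) p (e : nat -> R[i]) j : leja e ->
  e j ^+ (2 ^ p) = iter p (@square_seq R) e (j %/ 2 ^ p)%N.
Proof.
elim: p e j => [|p IH] e j le; first by rewrite expr1 divn1.
rewrite iterSr expnS exprM leja_square// IH; last exact: leja_square_seq.
by rewrite divnMA divn2.
Qed.

Lemma leja_block_dist (R : realType) p (e : nat -> R[i]) b z : leja e ->
  \prod_(t < 2 ^ p) cabs (z - e (b * 2 ^ p + t)%N) =
  cabs (z ^+ (2 ^ p) - iter p (@square_seq R) e b).
Proof.
elim: p e z => [|p IH] e z le; first by rewrite big_ord1 muln1 addn0 expr1.
rewrite iterSr expnS exprM -IH; last exact: leja_square_seq.
rewrite mul2n (@big_pairs _ _ _ _ (fun t => cabs (z - e (b * (2 ^ p).*2 + t)%N))).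
apply: eq_bigr => t _; rewrite /= addnS -doubleMr -doubleD leja_antipodal//.
by rewrite opprK -normcM -subr_sqr.
Qed.

(** The Lebesgue function of a finite list of distinct nodes; [lebesgue_fun] is
    indexed by positions of a sequence instead. *)
Definition lebesgue_sum (R : realType) (r : seq R[i]) (z : R[i]) : R :=
  \sum_(s <- r) \prod_(t <- r | t != s) cabs ((z - t) / (s - t)).

(** The point to check is that the supremum is over a bounded set: on the disc
    [|z - t| <= 1 + |t|]. *)
Lemma lebesgue_sum_le_const (R : realType) (r : seq R[i]) z : uniq r ->
  unit_disc z -> lebesgue_sum r z <= lebesgue_const (@unit_disc R) [set` r].
Proof.
move=> ur z1.
have sumE w : \sum_(s \in [set` r])
    \big[*%R/1]_(t \in [set` r] `\ s) cabs ((w - t) / (s - t)) = lebesgue_sum r w.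
  rewrite -fsbig_seq//; apply: eq_bigr => s _.
  rewrite (@fsbigE _ _ _ _ ([set` r] `\ s) [seq t <- r | t != s]).
  - rewrite -[RHS]big_filter big_seq_cond [RHS]big_seq; apply: eq_bigl => t.
    case: (boolP (t \in [seq t <- r | t != s])) => //.
    by rewrite mem_filter => /andP[/eqP ts tr]; apply/mem_set.
  - exact: filter_uniq.
  - by move=> t /=; rewrite mem_filter => /andP[/eqP ts tr].
  - by move=> t [/= tr /eqP ts]; rewrite mem_filter tr ts.
apply: ub_le_sup; last by exists z.
exists (\sum_(s <- r) \prod_(t <- r | t != s) ((1 + cabs t) * (cabs (s - t))^-1)).
move=> _ [w w1 <-]; rewrite sumE; apply: ler_sum => s _; apply: ler_prod => t _.
rewrite cabs_ge0 normcM normcV ler_wpM2r ?invr_ge0 ?cabs_ge0//.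
by rewrite (le_trans (le_normcD _ _))// normcN lerD2r.
Qed.

(** All quotients are roots of unity since [e_j ^ (2 ^ p)] is constant on a
    block, and there are [2 ^ p] distinct ones, the maximal number. *)
Lemma leja_block_unity_roots (R : realType) p (e : nat -> R[i]) a : leja e ->
  let r := [seq e (a * 2 ^ p + s)%N / e (a * 2 ^ p)%N | s <- index_iota 0 (2 ^ p)] in
  uniq r /\ [set` r] = @unity_roots R (2 ^ p).
Proof.
move=> le r; set N := (2 ^ p)%N in r *.
have N0 : (0 < N)%N by rewrite expn_gt0.
have e0 j : e j != 0 by rewrite -cabs_eq0 leja_cabs// oner_neq0.
have ur : uniq r.
  rewrite map_inj_in_uniq ?iota_uniq// => s t _ _ /(mulIf (invr_neq0 (e0 _))) est.
  apply/eqP; rewrite -(eqn_add2l (a * N)); apply/negPn/negP => /(leja_neq le).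
  by rewrite est eqxx.
have root_r z : z \in r -> z ^+ N = 1.
  case/mapP => s; rewrite mem_index_iota => /andP[_ sN] ->.
  rewrite expr_div_n !leja_exp2// divnMDl// divn_small// addn0 mulnK//.
  by rewrite divff// -(mulnK a N0) -leja_exp2// expf_neq0.
split=> //; apply/seteqP; split=> z /=; first exact: root_r.
move=> zN; apply/negPn/negP => zr.
have allr : all N.-unity_root (z :: r).
  by apply/allP => y; rewrite inE unity_rootE => /orP[/eqP ->|/root_r ->];
     rewrite ?zN.
have uzr : uniq (z :: r) by rewrite /= zr.
have := max_unity_roots N0 allr uzr.
by rewrite /= size_map size_iota subn0 ltnn.
Qed.

(** The sequence [e] serves to enumerate the roots of unity. *)
Lemma lebesgue_const_roots_ge0 (R : realType) p (e : nat -> R[i]) : leja e ->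
  0 <= lebesgue_const (@unit_disc R) (@unity_roots R (2 ^ p)).
Proof.
move=> le; have [ur <-] := @leja_block_unity_roots R p e 0 le.
apply: le_trans (lebesgue_sum_le_const ur (unit_disc0 R)).
by apply: sumr_ge0 => s _; apply: prodr_ge0 => t _; exact: cabs_ge0.
Qed.

(** Dividing the nodes and [z] by the first node of the block turns the block
    into the roots of unity and preserves the disc. *)
Lemma leja_block_lebesgue (R : realType) p (e : nat -> R[i]) a z : leja e ->
  unit_disc z ->
  \sum_(s < 2 ^ p) \prod_(t < 2 ^ p | (t : nat) != s)
     cabs ((z - e (a * 2 ^ p + t)%N) / (e (a * 2 ^ p + s)%N - e (a * 2 ^ p + t)%N))
  <= lebesgue_const (@unit_disc R) (@unity_roots R (2 ^ p)).
Proof.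
move=> le z1; have [ur <-] := @leja_block_unity_roots R p e a le.
set c := e (a * 2 ^ p)%N.
have c0 : c != 0 by rewrite -cabs_eq0 leja_cabs// oner_neq0.
have zc : unit_disc (z / c).
  by rewrite /unit_disc /mkset normcM normcV (leja_cabs _ le) invr1 mulr1.
apply: le_trans (lebesgue_sum_le_const ur zc).
rewrite /lebesgue_sum big_map big_mkord le_eqVlt; apply/orP; left; apply/eqP.
apply: eq_bigr => s _; rewrite big_map big_mkord; apply: eq_big => t.
  rewrite -/c (inj_eq (mulIf (invr_neq0 c0))).
  have [->|ts] := eqVneq (t : nat) s; first by rewrite eqxx.
  by rewrite leja_neq// eqn_add2l.
by move=> _; rewrite -/c -!mulrBl -mulf_div divff ?mulr1// invr_neq0.
Qed.

(** For [j] in block [a], [l_j(z)] is the product of the basis polynomial of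
    [e_j] inside its block and of the quotients of [z ^ N - G_b] by [G_a - G_b]
    for [b <> a], with [N = 2 ^ p]; the latter do not depend on the position of
    [j] in the block. *)
Lemma leja_lebesgue_fun_blocks (R : realType) p (e : nat -> R[i]) m z : leja e ->
  unit_disc z ->
  lebesgue_fun e (m * 2 ^ p) z <=
  lebesgue_fun (iter p (@square_seq R) e) m (z ^+ (2 ^ p)) *
  lebesgue_const (@unit_disc R) (@unity_roots R (2 ^ p)).
Proof.
move=> le z1; set N := (2 ^ p)%N; set G := iter p _ e.
have N0 : (0 < N)%N by rewrite expn_gt0.
rewrite /lebesgue_fun.
rewrite (@big_blocks _ _ _ m N (fun j => cabs (lagrange_basis e (m * N) j z))).
rewrite mulr_suml; apply: ler_sum => a _.
apply: le_trans (ler_wpM2l (cabs_ge0 _) (leja_block_lebesgue p a le z1)).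
rewrite mulr_sumr; apply: ler_sum => s _; rewrite -/N.
rewrite /lagrange_basis !cabs_prod.
rewrite (@big_blocks_excl _ _ _ m N a s (fun i =>
  cabs ((z - e i) / (e (a * N + s)%N - e i))))// mulrC.
rewrite le_eqVlt; apply/orP; left; apply/eqP; congr (_ * _).
apply: eq_bigr => b _.
under eq_bigr do rewrite normcM normcV.
rewrite prodf_div !leja_block_dist// (leja_exp2 _ _ le) divnMDl// divn_small// addn0.
by rewrite normcM normcV.
Qed.

(** * Difference operators *)

(** The difference of two successive interpolants is a multiple of the last
    basis polynomial, because this holds for each basis polynomial:
    [l_(j,k+1) - l_(j,k) = - l_(j,k)(e_k) l_(k,k+1)]. *)
Lemma diff_op_eq (R : realType) (e : nat -> R[i]) k f z :
  (forall j, (j < k)%N -> e k != e j) -> (0 < k)%N ->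
  diff_op e k f z =
  (f (e k) - lagrange_interp e k f (e k)) * lagrange_basis e k.+1 k z.
Proof.
case: k => // k dist _; rewrite /diff_op; move: k.+1 dist => {}k dist.
rewrite {1}/lagrange_interp big_ord_recr /= mulrBl [LHS]addrAC addrC; congr (_ + _).
rewrite /lagrange_interp mulr_suml -sumrB -sumrN; apply: eq_bigr => j _.
rewrite -mulrBr -mulrA -mulrN; congr (_ * _).
have ekj : e k - e j != 0 by rewrite subr_eq0 dist.
have -> : lagrange_basis e k.+1 j z =
    lagrange_basis e k j z * ((z - e k) / (e j - e k)).
  by rewrite /lagrange_basis big_mkcond big_ord_recr -big_mkcond /= gtn_eqF.
have -> : lagrange_basis e k.+1 k z =
    ((z - e j) / (e k - e j)) *
    \prod_(i < k | i != j) ((z - e i) / (e k - e i)).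
  rewrite /lagrange_basis big_mkcond big_ord_recr /= eqxx mulr1 -big_mkcond.
  rewrite (bigD1 j)/=; last by rewrite ltn_eqF.
  congr (_ * _); apply: eq_bigl => i; rewrite ltn_eqF//.
have <- : lagrange_basis e k j (e k) *
    \prod_(i < k | i != j) ((z - e i) / (e k - e i)) = lagrange_basis e k j z.
  rewrite /lagrange_basis -big_split /=; apply: eq_bigr => i ij.
  by rewrite mulrC mulrA divfK// subr_eq0 dist.
have jk : e j - e k != 0 by rewrite -opprB oppr_eq0.
by field; rewrite ekj.
Qed.

(** This is the maximality of [e_k], as [l_(k,k+1) = w_k / w_k(e_k)]. *)
Lemma leja_last_basis_le1 (R : realType) (e : nat -> R[i]) k z : leja e ->
  unit_disc z -> cabs (lagrange_basis e k.+1 k z) <= 1.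
Proof.
move=> le z1.
rewrite /lagrange_basis big_mkcond big_ord_recr /= eqxx mulr1.
under eq_bigr do rewrite ltn_eqF//=.
rewrite cabs_prod; under eq_bigr do rewrite normcM normcV.
rewrite prodf_div -/(node_dist e k z) -/(node_dist e k (e k)).
have D : 0 < node_dist e k (e k) by rewrite leja_node_dist// exprn_gt0.
rewrite ler_pdivrMr// mul1r.
have [->|k0] := posnP k; first by rewrite /node_dist !big_ord0.
by have [_] := le.2 k k0; apply.
Qed.

Lemma le_supnorm (R : realType) (X : set R[i]) (f : R[i] -> R[i]) z :
  has_ubound [set cabs (f z) | z in X] -> X z -> cabs (f z) <= supnorm X f.
Proof. by move=> ub Xz; apply: ub_le_sup => //; exists z. Qed.

(** When [|f|] is unbounded on [X], its supremum is 0 by convention and so is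
    the quotient; this leaves only bounded [f] to estimate. *)
Lemma diff_norm_le (R : realType) (X : set R[i]) (Z : nat -> R[i]) k (C : R) :
  0 <= C ->
  (forall f z, has_ubound [set cabs (f z) | z in X] -> X z ->
     cabs (diff_op Z k f z) <= C * supnorm X f) ->
  (diff_norm X Z k <= C%:E)%E.
Proof.
move=> C0 H; apply: ge_ereal_sup => _ [f [_ [z0 Xz0 fz0]] <-]; rewrite lee_fin.
have [ub|nub] := pselect (has_ubound [set cabs (f z) | z in X]); last first.
  rewrite [X in _ / X]sup_out ?invr0 ?mulr0//.
  by case=> _.
have M0 : 0 < supnorm X f.
  by apply: lt_le_trans (le_supnorm ub Xz0); rewrite cabs_gt0.
rewrite ler_pdivrMr//; apply: ge_sup; first by exists (cabs (diff_op Z k f z0)), z0.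
by move=> _ [z Xz <-]; exact: H.
Qed.

Lemma cabs_lagrange_interp_le (R : realType) (X : set R[i]) (Z : nat -> R[i]) k
    (f : R[i] -> R[i]) z :
  has_ubound [set cabs (f z) | z in X] -> (forall j, X (Z j)) ->
  cabs (lagrange_interp Z k f z) <= lebesgue_fun Z k z * supnorm X f.
Proof.
move=> ub XZ; apply: le_trans (cabs_sum_le _ _ _) _.
rewrite /lebesgue_fun mulr_suml; apply: ler_sum => j _.
by rewrite normcM mulrC ler_wpM2l ?cabs_ge0 ?le_supnorm.
Qed.

Lemma leja_diff_norm_le (R : realType) (e : nat -> R[i]) k : leja e -> (0 < k)%N ->
  (diff_norm (@unit_disc R) e k <= (1 + lebesgue_fun e k (e k))%:E)%E.
Proof.
move=> le k0.
have l0 : 0 <= lebesgue_fun e k (e k) by apply: sumr_ge0 => i _; exact: cabs_ge0.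
have De j : unit_disc (e j) by rewrite /unit_disc /mkset leja_cabs.
apply: diff_norm_le => [|f z ub z1]; first by rewrite addr_ge0.
rewrite diff_op_eq//; last by move=> j jk; rewrite leja_neq// gtn_eqF.
rewrite normcM -[leRHS]mulr1 ler_pM ?cabs_ge0 ?leja_last_basis_le1//.
apply: le_trans (le_normcD _ _) _.
by rewrite normcN mulrDl mul1r lerD ?le_supnorm ?cabs_lagrange_interp_le.
Qed.

Lemma leja_diff_norm0 (R : realType) (e : nat -> R[i]) :
  leja e -> diff_norm (@unit_disc R) e 0 = 1%E.
Proof.
move=> le.
have D0 f z : diff_op e 0 f z = f (e 0%N).
  by rewrite /diff_op /lagrange_interp big_ord1 /lagrange_basis big_ord1_cond mulr1.
have De j : unit_disc (e j) by rewrite /unit_disc /mkset leja_cabs.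
apply/eqP; rewrite eq_le; apply/andP; split.
  apply: diff_norm_le => // f z ub z1.
  by rewrite D0 mul1r le_supnorm.
apply: ereal_sup_ubound; exists (fun=> 1).
  split; first by move=> x; exact: cvg_cst.
  by exists 0; [exact: unit_disc0 | exact: oner_neq0].
have one : supnorm (@unit_disc R) (fun=> 1) = 1 :> R.
  rewrite /supnorm (_ : [set _ | _ in _] = [set 1]) ?sup1//.
  apply/seteqP; split=> [_ [z _ <-]|_ ->] /=; first exact: normc1.
  by exists 0; [exact: unit_disc0 | exact: normc1].
rewrite (_ : diff_op e 0 _ = fun=> 1) ?one ?divr1//.
by apply/funext => z; rewrite D0.
Qed.

Theorem theorem4p1 (R : realType) (E : nat -> R[i]) (hE : leja E) :
  diff_norm (@unit_disc R) E 0 = 1%E /\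
  forall k : nat, (0 < k)%N ->
    (diff_norm (@unit_disc R) E k <=
      (1 + Num.sqrt (k%:R / 2 ^+ logn 2 k * (2 ^+ sigma1 k - 1)) *
           lebesgue_const (@unit_disc R) (@unity_roots R (2 ^ logn 2 k)))%:E)%E.
Proof.
split=> [|k k0]; first exact: leja_diff_norm0.
apply: le_trans (leja_diff_norm_le hE k0) _; rewrite lee_fin lerD2l.
set p := logn 2 k.
have [m km] : exists m, k = (m * 2 ^ p)%N.
  by exists (k %/ 2 ^ p)%N; rewrite divnK// pfactor_dvdnn.
have -> : k%:R / 2 ^+ p = m%:R :> R.
  by rewrite km natrM natrX mulfK// expf_neq0.
have -> : sigma1 k = sigma1 m by rewrite km mulnC sigma1_mul_exp2.
rewrite [X in lebesgue_fun E X _]km.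
have Ek : unit_disc (E k) by rewrite /unit_disc /mkset leja_cabs.
apply: le_trans (leja_lebesgue_fun_blocks p m hE Ek) _.
rewrite ler_wpM2r ?(lebesgue_const_roots_ge0 p hE)//.
rewrite leja_exp2// km mulnK ?expn_gt0//.
exact/leja_lebesgue_fun_le/leja_iter_square.
Qed.
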